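(* Let $C$ be a multi-rotationally symmetric planar convex body, with maximal degree $k_C\in\mathbb{N}$. Then $C$ is $k$-rotationally symmetric for $k\in\mathbb{N}$ if and only if $k$ is a divisor of $k_C$ (greater than $1$).
   Context: A planar convex body is a compact convex subset of $\mathbb{R}^2$ with non-empty interior. For $k\in\mathbb{N}$, $k\geq 2$, a planar convex body $C$ is $k$-rotationally symmetric if there is a point $p\in C$ (the center of symmetry of $C$) such that $C$ is invariant under the rotation of angle $2\pi/k$ about $p$. $C$ is multi-rotationally symmetric if it is $k$-rotationally symmetric for more than one value of $k$. If $C$ is multi-rotationally symmetric and different from a circle (i.e. a disk), its maximal degree $k_C$ is the largest natural number $k$ for which $C$ is $k$-rotationally symmetric (for a circle the maximal degree is set as $+\infty$, so the hypothesis $k_C\in\mathbb{N}$ excludes circles). *)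

(* Defs.v *)
From HB Require Import structures.
From mathcomp Require Import all_boot all_order all_algebra.
From mathcomp Require Import all_classical all_reals all_analysis.
Import Order.TTheory GRing.Theory Num.Theory.
Import numFieldNormedType.Exports.

Set Implicit Arguments.
Unset Strict Implicit.
Unset Printing Implicit Defensive.

Local Open Scope classical_set_scope.
Local Open Scope ring_scope.

(* The norm of [R * R] is the sup norm, but its topology is the usual one of
   the Euclidean plane, and the norm enters only through its topology. *)
Definition planar_convex_body (R : realType) (C : set (R * R)) : Prop :=
  [/\ compact C, convex_set C & interior C !=set0].

Definition rotation (R : realType) (p : R * R) (t : R) (z : R * R) : R * R :=
  (p.1 + (cos t * (z.1 - p.1) - sin t * (z.2 - p.2)),
   p.2 + (sin t * (z.1 - p.1) + cos t * (z.2 - p.2))).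

(* The center [p] is not part of the data: it may a priori depend on [k]. *)
Definition rotationally_symmetric (R : realType) (k : nat) (C : set (R * R)) :
    Prop :=
  (2 <= k)%N /\
  exists2 p, C p & rotation p (2 * pi / k%:R) @` C = C.

Definition multi_rotationally_symmetric (R : realType) (C : set (R * R)) :
    Prop :=
  exists k1 k2 : nat,
    [/\ k1 <> k2, rotationally_symmetric k1 C & rotationally_symmetric k2 C].

(* Closed Euclidean disk; written with squares since [`|z|] is the sup norm. *)
Definition is_disk (R : realType) (C : set (R * R)) : Prop :=
  exists p : R * R, exists2 r : R, 0 < r &
    C = [set z | (z.1 - p.1) ^+ 2 + (z.2 - p.2) ^+ 2 <= r ^+ 2].

(* [C] has finite maximal degree [kC]. The maximal degree of a disk is +oo, so
   this never holds for a disk. *)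
Definition has_maximal_degree (R : realType) (C : set (R * R)) (kC : nat) :
    Prop :=
  [/\ ~ is_disk C, rotationally_symmetric kC C &
      forall k : nat, rotationally_symmetric k C -> (k <= kC)%N].

(* Main.v *)
Require Import Defs.
From mathcomp Require Import all_boot all_order all_algebra.
From mathcomp Require Import all_classical all_reals all_analysis.
From mathcomp Require Import ring lra.
Import Order.TTheory GRing.Theory Num.Theory.
Import numFieldNormedType.Exports.

(** The angles of the rotations about a fixed point that preserve [C] form a
    subgroup of the additive group of the reals, so everything is elementary
    arithmetic once all the symmetries of [C] are known to share one center.

    The common center ([rotation_center_unique]) comes from boundedness.  If
    [A] and [B] are rotations about [p] and [q], with complex multipliers [a]
    and [b], then [A B] and [B A] differ by the translation of vector
    [(1 - a) (1 - b) (p - q)] ([rotation_commutator]).  A set preserved by [A]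
    and [B] is preserved by this translation, and a nonempty compact set is
    preserved by no translation but the trivial one
    ([compact_translation_trivial]).  As [a] and [b] are not [1], [p = q].

    If [C] has the degrees [k] and [m], Bezout writes [gcd(k, m)] as
    [u m - v k], so the angle [2 pi / lcm(k, m)] is
    [u (2 pi / k) - v (2 pi / m)], and the least common multiple is again a
    degree ([rotationally_symmetric_lcm]).  When [m] is the maximal degree, this
    forces [lcm(k, m) = m], that is, [k] divides [m].  Conversely a divisor of a
    degree is a degree, by iterating the smaller rotation
    ([rotationally_symmetric_dvd]). *)

Local Open Scope classical_set_scope.
Local Open Scope ring_scope.

Lemma rotationD {R : realType} (p : R * R) (s t : R) (z : R * R) :
  rotation p (s + t) z = rotation p s (rotation p t z).
Proof. by rewrite /rotation /= cosD sinD; congr pair; ring. Qed.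

Lemma rotation0 {R : realType} (p : R * R) (z : R * R) : rotation p 0 z = z.
Proof.
by case: z => x y; rewrite /rotation /= cos0 sin0; congr pair; ring.
Qed.

Lemma rotation_stable0 {R : realType} (p : R * R) (C : set (R * R)) :
  rotation p 0 @` C = C.
Proof. by apply: eq_image_id => z _; exact: rotation0. Qed.

Lemma rotation_stableD {R : realType} (p : R * R) (C : set (R * R)) (s t : R) :
  rotation p s @` C = C -> rotation p t @` C = C ->
  rotation p (s + t) @` C = C.
Proof.
move=> hs ht; rewrite (_ : rotation p (s + t) = rotation p s \o rotation p t).
  by rewrite -image_comp ht hs.
by apply/funext => z; exact: rotationD.
Qed.

Lemma rotation_stableN {R : realType} (p : R * R) (C : set (R * R)) (t : R) :
  rotation p t @` C = C -> rotation p (- t) @` C = C.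
Proof.
move=> ht; rewrite -[in LHS]ht image_comp.
apply: eq_image_id => z _ /=.
by rewrite -rotationD addNr rotation0.
Qed.

Lemma rotation_stableMn {R : realType} (p : R * R) (C : set (R * R)) (t : R)
    (n : nat) :
  rotation p t @` C = C -> rotation p (n%:R * t) @` C = C.
Proof.
move=> ht; elim: n => [|n IHn]; first by rewrite mul0r rotation_stable0.
by rewrite -addn1 natrD mulrDl mul1r; exact: rotation_stableD.
Qed.

(** The linear form [z |-> <z, v>] attains its maximum on [C], and translating
    by [v] increases it by [|v|^2]. *)
Lemma compact_translation_trivial {R : realType} (C : set (R * R))
    (v : R * R) :
  C !=set0 -> compact C ->
  (forall z, C z -> C (z.1 + v.1, z.2 + v.2)) -> v = (0, 0).
Proof.
move=> C0 cC hv.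
pose f (z : R * R) : R := z.1 * v.1 + z.2 * v.2.
have cf : continuous f.
  move=> z; apply: cvgD; apply: cvgM; try exact: cvg_cst.
    exact: cvg_fst.
  exact: cvg_snd.
have [z /set_mem Cz zmax] :=
  compact_EVT_max C0 cC (continuous_subspaceT cf).
have := zmax _ (mem_set (hv _ Cz)).
rewrite /f /= => fle.
have : v.1 ^+ 2 + v.2 ^+ 2 == 0.
  by rewrite eq_le addr_ge0 ?sqr_ge0 // andbT; lra.
rewrite paddr_eq0 ?sqr_ge0 // !sqrf_eq0 => /andP[/eqP v1 /eqP v2].
by rewrite [LHS]surjective_pairing v1 v2.
Qed.

(** In complex notation, with [a] and [b] the multipliers [exp(i s)] and
    [exp(i t)], the two composites differ by [(1 - a) (1 - b) (p - q)]. *)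
Definition commutator_vector {R : realType} (p q : R * R) (s t : R) : R * R :=
  let u1 := (1 - cos s) * (1 - cos t) - sin s * sin t in
  let u2 := - ((1 - cos s) * sin t + sin s * (1 - cos t)) in
  (u1 * (p.1 - q.1) - u2 * (p.2 - q.2), u2 * (p.1 - q.1) + u1 * (p.2 - q.2)).

Lemma rotation_commutator {R : realType} (p q : R * R) (s t : R) (z : R * R) :
  rotation p s (rotation q t z) =
  ((rotation q t (rotation p s z)).1 + (commutator_vector p q s t).1,
   (rotation q t (rotation p s z)).2 + (commutator_vector p q s t).2).
Proof. by rewrite /rotation /commutator_vector /=; congr pair; ring. Qed.

(** The squared length of the vector is [|1 - a|^2 |1 - b|^2 |p - q|^2], and
    [|1 - a|^2 = 2 (1 - cos s)]. *)
Lemma commutator_vector_eq0 {R : realType} (p q : R * R) (s t : R) :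
  cos s != 1 -> cos t != 1 -> commutator_vector p q s t = (0, 0) -> p = q.
Proof.
move=> cs ct [v1 v2].
have : 4 * (1 - cos s) * (1 - cos t) *
    ((p.1 - q.1) ^+ 2 + (p.2 - q.2) ^+ 2) = 0.
  have es : (1 - cos s) ^+ 2 + sin s ^+ 2 = 2 * (1 - cos s).
    by rewrite sin2cos2; ring.
  have et : (1 - cos t) ^+ 2 + sin t ^+ 2 = 2 * (1 - cos t).
    by rewrite sin2cos2; ring.
  transitivity ((commutator_vector p q s t).1 ^+ 2 +
                (commutator_vector p q s t).2 ^+ 2).
    rewrite (_ : 4 * (1 - cos s) * (1 - cos t) =
      (2 * (1 - cos s)) * (2 * (1 - cos t))); last by ring.
    by rewrite -es -et /commutator_vector /=; ring.
  by rewrite /= v1 v2 expr0n addr0.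
move/eqP; rewrite !mulf_eq0 pnatr_eq0 /= !subr_eq0 ![1 == _]eq_sym.
rewrite (negbTE cs) (negbTE ct) /=.
rewrite paddr_eq0 ?sqr_ge0 // !sqrf_eq0 !subr_eq0 => /andP[/eqP pq1 /eqP pq2].
by rewrite [LHS]surjective_pairing pq1 pq2 -surjective_pairing.
Qed.

Lemma rotation_center_unique {R : realType} (C : set (R * R)) (p q : R * R)
    (s t : R) :
  C !=set0 -> compact C -> cos s != 1 -> cos t != 1 ->
  rotation p s @` C = C -> rotation q t @` C = C -> p = q.
Proof.
move=> C0 cC cs ct hs ht; apply: (commutator_vector_eq0 p q s t cs ct).
apply: (compact_translation_trivial C) => // z Cz.
have : ((rotation q t \o rotation p s) @` C) z by rewrite -image_comp hs ht.
move=> [w Cw /= <-]; rewrite -rotation_commutator.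
by rewrite -hs; exists (rotation q t w) => //; rewrite -ht; exists w.
Qed.

(** As [k >= 2], the angle lies in the interval from [0] (excluded) to [pi], on
    which the cosine is strictly decreasing from [1]. *)
Lemma cos_2pi_div_neq1 {R : realType} (k : nat) :
  (2 <= k)%N -> cos (2 * pi / k%:R : R) != 1.
Proof.
move=> k2; have k0 : 0 < k%:R :> R by rewrite ltr0n (ltn_trans _ k2).
have a0 : 0 < 2 * pi / k%:R :> R by rewrite divr_gt0 // mulr_gt0 // pi_gt0.
have api : 2 * pi / k%:R <= pi :> R.
  by rewrite ler_pdivrMr // mulrC ler_wpM2l ?pi_ge0 // ler_nat.
by rewrite lt_eqF // -[ltRHS]cos0 ltr_cos // in_itv /= ?lexx ?pi_ge0 ?api ?ltW.
Qed.

Lemma rotationally_symmetric_dvd {R : realType} (C : set (R * R))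
    (k m : nat) :
  rotationally_symmetric m C -> (k %| m)%N -> (1 < k)%N ->
  rotationally_symmetric k C.
Proof.
move=> [m2 [p Cp hp]] /dvdnP[d dE] k1; split=> //; exists p => //.
have m0 : m%:R != 0 :> R by rewrite pnatr_eq0 -lt0n ltnW.
rewrite (_ : 2 * pi / k%:R = d%:R * (2 * pi / m%:R)).
  exact: rotation_stableMn.
by move: m0; rewrite dE natrM mulf_eq0 negb_or => /andP[d0 k0]; field; apply/andP.
Qed.

Lemma rotationally_symmetric_lcm {R : realType} (C : set (R * R))
    (k m : nat) :
  compact C -> rotationally_symmetric k C -> rotationally_symmetric m C ->
  rotationally_symmetric (lcmn k m) C.
Proof.
move=> cC [k2 [p Cp hp]] [m2 [q Cq hq]].
have k0 : (0 < k)%N by exact: ltnW.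
have m0 : (0 < m)%N by exact: ltnW.
have qp : q = p.
  apply: (rotation_center_unique C q p _ _ _ cC _ _ hq hp); first by exists p.
  - exact: cos_2pi_div_neq1.
  - exact: cos_2pi_div_neq1.
rewrite {q Cq}qp in hq.
split.
  by apply: (leq_trans k2); rewrite dvdn_leq ?lcmn_gt0 ?k0 ?m0 ?dvdn_lcml.
exists p => //.
have [u v uvE _] := egcdnP k m0.
(* [u m = v k + gcd(m, k)], divided by [k m = lcm(k, m) gcd(m, k)] *)
rewrite (_ : 2 * pi / _ = u%:R * (2 * pi / k%:R) + - (v%:R * (2 * pi / m%:R))).
  apply: rotation_stableD; first exact: rotation_stableMn.
  exact/rotation_stableN/rotation_stableMn.
have lg : (lcmn k m)%:R * (gcdn m k)%:R = k%:R * m%:R :> R.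
  by rewrite -!natrM gcdnC muln_lcm_gcd.
have uv : u%:R * m%:R = v%:R * k%:R + (gcdn m k)%:R :> R.
  by rewrite -!natrM -natrD uvE.
have kR : k%:R != 0 :> R by rewrite pnatr_eq0 -lt0n.
have mR : m%:R != 0 :> R by rewrite pnatr_eq0 -lt0n.
have lR : (lcmn k m)%:R != 0 :> R by rewrite pnatr_eq0 -lt0n lcmn_gt0 k0 m0.
have gE : (gcdn m k)%:R = u%:R * m%:R - v%:R * k%:R :> R.
  by rewrite uv addrC addKr.
have : (lcmn k m)%:R^-1 = (u%:R * m%:R - v%:R * k%:R) / (k%:R * m%:R) :> R.
  rewrite -gE -lg; field; rewrite lR /=.
  by rewrite pnatr_eq0 -lt0n gcdn_gt0 m0.
by move=> ->; field; rewrite kR mR.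
Qed.

Theorem lemma2p6 (R : realType) (C : set (R * R)) (kC : nat)
    (hC : planar_convex_body C) (hmulti : multi_rotationally_symmetric C)
    (hkC : has_maximal_degree C kC) :
  forall k : nat,
    rotationally_symmetric k C <-> (k %| kC)%N /\ (1 < k)%N.
Proof.
case: hC => cC _ _; case: hkC => _ symC maxC k; split=> [symk | [kdvd k1]].
  split; last by case: symk.
  have /maxC lcm_le := rotationally_symmetric_lcm C k kC cC symk symC.
  have kC0 : (0 < kC)%N by case: symC => kC2 _; exact: ltnW.
  have k0 : (0 < k)%N by case: symk => k2 _; exact: ltnW.
  suff <- : lcmn k kC = kC by exact: dvdn_lcml.
  apply/eqP; rewrite eqn_leq lcm_le dvdn_leq ?dvdn_lcmr //.
  by rewrite lcmn_gt0 k0 kC0.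
exact: rotationally_symmetric_dvd symC kdvd k1.
Qed.
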